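(* $$\int_0^{\pi/2} e^{-\sin^2(x)}\,dx = \frac{\pi}{2}\,e^{-1/2}\, I_0\!\left(\frac{1}{2}\right).$$
   Context: For an integer $n$ and $\mathrm{Re}(z)>0$, $I_n(z)=\frac{1}{\pi}\int_0^{\pi} e^{z\cos\theta}\cos(n\theta)\,d\theta$ is the modified Bessel function of the first kind. *)

(* Defs.v *)
From Stdlib Require Import Reals ZArith.
From Coquelicot Require Import Coquelicot.
Open Scope R_scope.

(* Coquelicot has no complex exponential; e^(a + ib) = e^a (cos b + i sin b). *)
Definition Cexp (z : C) : C :=
  (exp (Re z) * cos (Im z), exp (Re z) * sin (Im z)).

(* The instance [C_R_CompleteNormedModule] (C as a real Banach space) is given
   explicitly: the canonical one on C has complex scalars, whereas the integral
   is over a real variable. Intended for Re z > 0. *)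
Definition besselI (n : Z) (z : C) : C :=
  (RtoC (/ PI) *
   @RInt C_R_CompleteNormedModule
     (fun theta : R =>
        (Cexp (z * RtoC (cos theta)) * RtoC (cos (IZR n * theta)))%C)
     0 PI)%C.

(* Main.v *)
Require Import Defs.
From Stdlib Require Import Reals ZArith.
From Coquelicot Require Import Coquelicot.
Open Scope R_scope.

(** Since sin^2 x = (1 - cos 2x)/2, the integrand equals e^(-1/2) e^(cos(2x)/2) ([exp_neg_sin_sqr]).
    The substitution t = 2x carries [0, pi/2] to [0, pi] at the cost of a factor 1/2, and the
    integral of e^(cos(t)/2) over [0, pi] is pi I_0(1/2), once the complex integral defining I_0 is
    reduced to a real one ([besselI_0_real]). *)

Lemma ex_RInt_continuous_everywhere (f : R -> R) (a b : R) :
  (forall x, continuous f x) -> ex_RInt f a b.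
Proof. intros Hf; apply (ex_RInt_continuous (V := R_CompleteNormedModule)); auto. Qed.

Lemma is_RInt_RtoC (f : R -> R) (a b l : R) :
  is_RInt f a b l ->
  @is_RInt C_R_NormedModule (fun x => RtoC (f x)) a b (RtoC l).
Proof.
  intros Hf.
  apply (is_RInt_fct_extend_pair (U := R_NormedModule) (V := R_NormedModule)
           (fun x => RtoC (f x)) a b l 0).
  - exact Hf.
  (* The imaginary part is constantly 0; its integral comes out as (b - a) * 0. *)
  - evar_last.
    + exact (is_RInt_const (V := R_NormedModule) a b 0).
    + apply Rmult_0_r.
Qed.

Lemma Cexp_RtoC (x : R) : Cexp (RtoC x) = RtoC (exp x).
Proof.
  unfold Cexp, RtoC; simpl; rewrite cos_0, sin_0; f_equal; ring.
Qed.

Lemma continuous_exp_mul_cos (r x : R) :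
  continuous (fun t => exp (r * cos t)) x.
Proof.
  apply (ex_derive_continuous (K := R_AbsRing) (V := R_NormedModule));
  auto_derive; trivial.
Qed.

(** At order 0 the factor cos(n theta) is 1, and at a real argument the exponential is real, so the
    integrand has no imaginary part. *)
Lemma besselI_0_real (r : R) :
  besselI 0%Z (RtoC r) = RtoC (/ PI * RInt (fun t => exp (r * cos t)) 0 PI).
Proof.
  unfold besselI; rewrite RtoC_mult; f_equal.
  apply (is_RInt_unique (V := C_R_CompleteNormedModule)).
  apply is_RInt_ext with (f := fun t => RtoC (exp (r * cos t))).
  - intros t _.
    rewrite Rmult_0_l, cos_0, <- RtoC_mult, Cexp_RtoC.
    symmetry; apply Cmult_1_r.
  - apply is_RInt_RtoC, (RInt_correct (V := R_CompleteNormedModule)).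
    apply ex_RInt_continuous_everywhere, continuous_exp_mul_cos.
Qed.

(** The right side is shaped for the substitution rule, as a constant times u f(u x + v) with u = 2
    and v = 0; the [/ 2] compensates the Jacobian 2. *)
Lemma exp_neg_sin_sqr (x : R) :
  exp (- (sin x) ^ 2) =
  exp (- (1 / 2)) * / 2 * (2 * exp (1 / 2 * cos (2 * x + 0))).
Proof.
  rewrite Rplus_0_r, cos_2a_sin.
  transitivity (exp (- (1 / 2)) * exp (1 / 2 * (1 - 2 * sin x * sin x))).
  - rewrite <- exp_plus; f_equal; field.
  - field.
Qed.

Theorem theorem3p7 :
  RtoC (RInt (fun x : R => exp (- (sin x) ^ 2)) 0 (PI / 2)) =
  (RtoC (PI / 2 * exp (- (1 / 2))) * besselI 0%Z (RtoC (1 / 2)))%C.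
Proof.
  rewrite besselI_0_real, <- RtoC_mult; f_equal.
  set (J := RInt (fun t => exp (1 / 2 * cos t)) 0 PI).
  (* The factor pi cancels the 1/pi from [besselI], leaving the constant of [exp_neg_sin_sqr]. *)
  replace (PI / 2 * exp (- (1 / 2)) * (/ PI * J))
    with (exp (- (1 / 2)) * / 2 * J) by (field; exact PI_neq0).
  apply (is_RInt_unique (V := R_CompleteNormedModule)).
  apply is_RInt_ext with
    (f := fun x => scal (exp (- (1 / 2)) * / 2)
                     (scal 2 (exp (1 / 2 * cos (2 * x + 0))))).
  - intros x _; symmetry; apply exp_neg_sin_sqr.
  - apply (is_RInt_scal (V := R_NormedModule)).
    apply (is_RInt_comp_lin (V := R_NormedModule) (fun t => exp (1 / 2 * cos t))).
    replace (2 * 0 + 0) with 0 by ring.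
    replace (2 * (PI / 2) + 0) with PI by field.
    apply (RInt_correct (V := R_CompleteNormedModule)).
    apply ex_RInt_continuous_everywhere, continuous_exp_mul_cos.
Qed.
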